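(* If a compact space $X$ is I-favorable, then the hyperspace $\exp(X)$ with the Vietoris topology is I-favorable, too.
   Context: The game on a topological space $X$: two players play rounds $n=0,1,2,\ldots$. At round $n$, Player I chooses a finite family $\mathcal{A}_n$ of non-empty open subsets of $X$; then Player II chooses a finite family $\mathcal{B}_n$ of non-empty open subsets of $X$ such that for each $U\in\mathcal{A}_n$ there exists $V\in\mathcal{B}_n$ with $V\subseteq U$. Player I wins if for every natural number $k$ the union $\bigcup(\mathcal{B}_k\cup\mathcal{B}_{k+1}\cup\ldots)$ is dense in $X$; otherwise Player II wins. The space $X$ is I-favorable if Player I has a winning strategy, i.e. a function $\sigma$ assigning to each finite sequence $(\mathcal{B}_0,\ldots,\mathcal{B}_n)$ (including the empty sequence) of finite families of non-empty open sets a finite family $\sigma(\mathcal{B}_0,\ldots,\mathcal{B}_n)$ of non-empty open sets, such that Player I wins every game in which $\mathcal{A}_0=\sigma(\emptyset)$ and $\mathcal{A}_{n+1}=\sigma(\mathcal{B}_0,\ldots,\mathcal{B}_n)$ for all $n$. The hyperspace $\exp(X)$ is the set of all non-empty closed subsets of $X$; the Vietoris topology on it has as a base the sets $\langle V_1,\ldots,V_n\rangle=\{A\in\exp(X): A\subseteq V_1\cup\cdots\cup V_n\text{ and }A\cap V_i\neq\emptyset\text{ for }1\leq i\leq n\}$, where $n\geq 1$ and $V_1,\ldots,V_n$ are open subsets of $X$. *)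

(* Defs.v *)
From HB Require Import structures.
From mathcomp Require Import all_boot all_order.
From mathcomp Require Import all_classical topology.

Set Implicit Arguments.
Unset Strict Implicit.
Unset Printing Implicit Defensive.

Local Open Scope classical_set_scope.

Definition open_families (X : topologicalType) : set (set (set X)) :=
  [set F | finite_set F /\ forall U, F U -> open U /\ U !=set0].
Arguments open_families : clear implicits.

(* Type of the moves of both players: the families are unindexed, since the
   rules only depend on which sets occur in them. *)
Definition open_family (X : topologicalType) : Type := set_type (open_families X).

Definition refines (X : topologicalType) (B A : open_family X) : Prop :=
  forall U, val A U -> exists2 V, val B V & V `<=` U.

(* A play is recorded by the answers B 0, B 1, ... of Player II. *)
Definition I_wins (X : topologicalType) (B : nat -> open_family X) : Prop :=
  forall k : nat,
    dense (\bigcup_(n in [set n | k <= n]) \bigcup_(V in val (B n)) V).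

Definition strategy (X : topologicalType) : Type := seq (open_family X) -> open_family X.

(* [mkseq B n] is [:: B 0; ...; B n.-1], so Player I opens with s [::]. *)
Definition winning_strategy (X : topologicalType) (s : strategy X) : Prop :=
  forall B : nat -> open_family X,
    (forall n, refines (B n) (s (mkseq B n))) -> I_wins B.

Definition I_favorable (X : topologicalType) : Prop :=
  exists s : strategy X, winning_strategy s.

Definition hyperspace (X : topologicalType) : Type :=
  set_type [set A : set X | closed A /\ A !=set0].

HB.instance Definition _ (X : topologicalType) :=
  Choice.on (hyperspace X).

(* The index type 'I_n.+1 encodes families V_1, ..., V_n with n >= 1. *)
Definition vietoris (X : topologicalType) (n : nat) (V : 'I_n.+1 -> set X) :
    set (hyperspace X) :=
  [set A | val A `<=` \bigcup_i V i /\ forall i, val A `&` V i !=set0].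

Definition vietoris_open (X : topologicalType) : set (set (hyperspace X)) :=
  [set O | forall A, O A -> exists n (V : 'I_n.+1 -> set X),
    [/\ forall i, open (V i), vietoris V A & vietoris V `<=` O]].

Section vietoris_topology.
Variable X : topologicalType.

Let vietoris_openT : vietoris_open [set: hyperspace X].
Proof.
move=> A _; exists 0, (fun=> setT); split => //; first by move=> _; exact: openT.
split=> [x _|_]; first by exists ord0.
by have [_ [x Ax]] := set_valP A; exists x.
Qed.

Let vietoris_openI (O1 O2 : set (hyperspace X)) :
  vietoris_open O1 -> vietoris_open O2 -> vietoris_open (O1 `&` O2).
Proof.
move=> o1 o2 A [/o1[n [V [oV [AV mV] VO]]] /o2[m [W [oW [AW mW] WO]]]].
pose F (i : 'I_(n.+1 + m.+1)) := match fintype.split i with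
  | inl j => V j `&` \bigcup_k W k | inr j => W j `&` \bigcup_k V k end.
have Fl j : F (lshift m.+1 j) = V j `&` \bigcup_k W k.
  by rewrite /F; have := unsplitK (inl j : 'I_n.+1 + 'I_m.+1) => /= ->.
have Fr j : F (rshift n.+1 j) = W j `&` \bigcup_k V k.
  by rewrite /F; have := unsplitK (inr j : 'I_n.+1 + 'I_m.+1) => /= ->.
exists (n + m.+1), F; split.
- by move=> i; rewrite /F; case: (@fintype.split n.+1 m.+1 i) => j; apply: openI => //;
    apply: bigcup_open.
- split=> [x Ax|i].
    have [j _ Vx] := AV x Ax.
    by exists (lshift m.+1 j) => //; rewrite Fl; split=> //; exact: AW.
  rewrite /F; case: (@fintype.split n.+1 m.+1 i) => j.
    by have [x [Ax Vx]] := mV j; exists x; split=> //; split=> //; exact: AW.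
  by have [x [Ax Wx]] := mW j; exists x; split=> //; split=> //; exact: AV.
- move=> C [CF mC]; split; [apply: VO|apply: WO]; split.
  + move=> x /CF[i _]; rewrite /F.
    by case: (@fintype.split n.+1 m.+1 i) => j [p q] //; exists j.
  + by move=> j; have [x] := mC (lshift m.+1 j); rewrite Fl => -[Cx [Vx _]];
      exists x.
  + move=> x /CF[i _]; rewrite /F.
    by case: (@fintype.split n.+1 m.+1 i) => j [p q] //; exists j.
  + by move=> j; have [x] := mC (rshift n.+1 j); rewrite Fr => -[Cx [Wx _]];
      exists x.
Qed.

Let vietoris_open_bigU (I : Type) (f : I -> set (hyperspace X)) :
  (forall i, vietoris_open (f i)) -> vietoris_open (\bigcup_i f i).
Proof.
move=> of_ A [i _ /of_[n [V [oV VA Vf]]]]; exists n, V; split=> //.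
by move=> B /Vf fB; exists i.
Qed.

HB.instance Definition _ := isOpenTopological.Build (hyperspace X)
  vietoris_openT vietoris_openI vietoris_open_bigU.

End vietoris_topology.

(* Compactness includes the Hausdorff axiom. Some separation is needed for
   I-favorability to pass to the hyperspace: let Y be compact, T1 and not ccc,
   add a point q to Y, and let the open sets be the empty set and all sets
   U with q adjoined, for U open in Y. This space is quasi-compact, and it is
   I-favorable since {q} is open and dense, but its hyperspace is not ccc,
   hence not I-favorable. *)
Definition compact_space (X : topologicalType) : Prop :=
  compact [set: X] /\ hausdorff_space X.

(* Main.v *)
(** Let [s] be a winning strategy on [X].  In the game on the hyperspace,
    Player I keeps a finite family [P_n] of non-empty open subsets of [X] and
    plays all the sets <F> with F a non-empty subfamily of [P_n]; [P_(n+1)] is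
    obtained by adding to [P_n] a family G refining F with <G> contained in
    an answer to <F>, and the values of [s] on short sequences of subfamilies
    of [P_n].  Let [P] be the union of the [P_n].  Every non-empty open W
    then has some U in [P] such that each member of [P] inside U meets W:
    otherwise Player II could beat [s] by answering inside [P] with sets that
    miss W.  Given a non-empty <W_1, ..., W_m>, choose U_i for W_i in this
    way.  A late answer to <U_1, ..., U_m> contains some <G> with G in [P]
    refining the U_i, so each member of G meets some W_i and each W_i meets a
    member of G; a finite set of points chosen in these intersections belongs
    to <G> and to <W_1, ..., W_m>, and it is closed in [X]. *)

Require Import Defs.
From mathcomp Require Import all_boot all_order.
From mathcomp Require Import all_classical topology.

Set Implicit Arguments.
Unset Strict Implicit.
Unset Printing Implicit Defensive.

Local Open Scope classical_set_scope.

(** * Finite families and finite words *)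

Lemma finite_powerset (T : choiceType) (A : set T) :
  finite_set A -> finite_set [set B | B `<=` A].
Proof.
move=> /finite_seqP[s ->].
(* Every subset is cut out of the enumeration [s] by one of finitely many boolean masks. *)
apply: (@sub_finite_set _ _
  (range (fun m : (size s).-tuple bool => [set` mask m s]))); last first.
  exact/finite_image/finite_finset.
move=> B Bs; exists (map_tuple (fun x => x \in B) (in_tuple s)) => //=.
rewrite -filter_mask; apply/seteqP; split=> x /=.
  by rewrite mem_filter => /andP[/set_mem].
by move=> Bx; rewrite mem_filter mem_set//=; exact: Bs.
Qed.

(** Families in the game are unindexed, so a choice is recorded by its image [D]; the last clause
    keeps every member of [D] tied to some [a]. *)
Lemma finite_choice (T U : Type) (A : set T) (R : T -> U -> Prop) :
  finite_set A -> (forall a, A a -> exists b, R a b) ->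
  exists D, [/\ finite_set D, forall a, A a -> exists2 b, D b & R a b &
    forall b, D b -> exists2 a, A a & R a b].
Proof.
move=> finA AR; have [[a0 Aa0]|A0] := pselect (A !=set0); last first.
  by exists set0; split=> // a Aa; case: A0; exists a.
have [b0 _] := AR _ Aa0.
have /choice[f fR] a : exists b, A a -> R a b.
  by have [/AR[b Rab]|nAa] := pselect (A a); [exists b | exists b0].
exists (f @` A); split; first exact: finite_image.
- by move=> a Aa; exists (f a); [exists a | exact: fR].
- by move=> _ [a Aa <-]; exists a => //; exact: fR.
Qed.

(** Lengths up to [n] are allowed: the empty word occurs at every level. *)
Fixpoint words (T : Type) (A : set T) n : set (seq T) :=
  if n is m.+1 then
    [set [::]] `|` [set p.1 :: p.2 | p in A `*` words A m]
  else [set [::]].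

Lemma finite_words (T : Type) (A : set T) n :
  finite_set A -> finite_set (words A n).
Proof.
move=> finA; elim: n => [|n IHn] /=; first exact: finite_set1.
rewrite finite_setU; split; first exact: finite_set1.
exact/finite_image/finite_setX.
Qed.

Lemma words_map (I : eqType) (T : Type) (A : set T) (f : I -> T) n (r : seq I) :
  size r <= n -> (forall i, i \in r -> A (f i)) -> words A n (map f r).
Proof.
elim: r n => [|i r IHr] [|n]//=; first by left.
move=> rn Af; right; exists (f i, map f r) => //=; split=> /=.
  by apply: Af; rewrite mem_head.
by apply: IHr => // j jr; apply: Af; rewrite in_cons jr orbT.
Qed.

(** * Vietoris sets of finite families *)

Section hyperspace_of_families.
Variable X : topologicalType.
Implicit Types F G P : set (set X).

(** This is <F> for an unindexed family. Points of the hyperspace are non-empty, so <F> is empty for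
    empty [F]; this is why [moves] asks for [F !=set0]. *)
Definition vietoris_family F : set (hyperspace X) :=
  [set A | val A `<=` \bigcup_(V in F) V /\
           forall V, F V -> val A `&` V !=set0].

Lemma vietoris_range n (V : 'I_n.+1 -> set X) :
  vietoris V = vietoris_family (range V).
Proof.
rewrite /vietoris_family bigcup_image; apply/seteqP; split=> A [AV mA].
  by split=> // _ [i _ <-].
by split=> // i; apply: mA; exists i.
Qed.

Lemma finite_range_ord F : finite_set F -> F !=set0 ->
  exists n (V : 'I_n.+1 -> set X), F = range V.
Proof.
move=> /finite_seqP[[|U r] ->] [V0 V0r] //.
exists (size r), (fun i => nth set0 (U :: r) i); apply/seteqP; split=> V.
  move=> /= Vr.
  have Vs : index V (U :: r) < size (U :: r) by rewrite index_mem.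
  by exists (Ordinal Vs) => //=; rewrite nth_index.
by move=> [i _ <-]; apply: mem_nth; exact: ltn_ord.
Qed.

Lemma open_vietoris_family F :
  open_families X F -> F !=set0 -> open (vietoris_family F).
Proof.
move=> [finF oF] F0; have [n [V FV]] := finite_range_ord finF F0.
move=> A FA; exists n, V; rewrite vietoris_range -FV; split=> // i.
by have [] := oF (V i); rewrite // FV; exists i.
Qed.

Lemma vietoris_family_base (O : set (hyperspace X)) (A : hyperspace X) :
  open O -> O A -> exists F, [/\ open_families X F, F !=set0,
    vietoris_family F A & vietoris_family F `<=` O].
Proof.
move=> oO /oO[n [V [oV VA VO]]]; exists (range V).
rewrite -vietoris_range; split=> //; last by exists (V ord0), ord0.
split; first exact/finite_image/finite_finset.
move=> _ [i _ <-]; split; first exact: oV.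
by have [_ /(_ i)[x [_ Vx]]] := VA; exists x.
Qed.

Hypothesis T1 : accessible_space X.

(** One point from each required intersection gives a finite set, which is closed because the space
    is T1, and which lies in both Vietoris sets. *)
Lemma vietoris_family_meet F G : finite_set F -> finite_set G -> F !=set0 ->
    (forall U, F U -> exists2 V, G V & U `&` V !=set0) ->
    (forall V, G V -> exists2 U, F U & U `&` V !=set0) ->
  vietoris_family F `&` vietoris_family G !=set0.
Proof.
move=> finF finG [U0 FU0] FG GF.
pose R U x := U x /\ exists2 V, G V & V x.
pose S V x := V x /\ exists2 U, F U & U x.
have [U /FG[V GV [x [Ux Vx]]]|D [finD FD DF]] :=
  @finite_choice _ _ F R finF.
  by exists x; split=> //; exists V.
have [V /GF[U FU [x [Ux Vx]]]|E [finE GE EG]] :=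
  @finite_choice _ _ G S finG.
  by exists x; split=> //; exists U.
have cDE : closed (D `|` E).
  by apply: accessible_finite_set_closed.1 => //; rewrite finite_setU.
have DE0 : D `|` E !=set0.
  by have [x Dx _] := FD _ FU0; exists x; left.
pose A : hyperspace X := exist _ (D `|` E) (mem_set (conj cDE DE0)).
exists A; split; split.
- move=> x [/DF[U FU [Ux _]]|/EG[V GV [Vx [U FU Ux]]]]; by exists U.
- by move=> U /FD[x Dx [Ux _]]; exists x; split=> //; left.
- move=> x [/DF[U FU [Ux [V GV Vx]]]|/EG[V GV [Vx _]]]; by exists V.
- by move=> V /GE[x Ex [Vx _]]; exists x; split=> //; right.
Qed.

Lemma vietoris_family_neq0 F :
  open_families X F -> F !=set0 -> vietoris_family F !=set0.
Proof.
move=> [finF oF] F0.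
have FF U : F U -> exists2 V, F V & U `&` V !=set0.
  by move=> FU; exists U => //; rewrite setIid; have [] := oF U FU.
have [|A [FA _]] := @vietoris_family_meet F F finF finF F0 FF; last by exists A.
by move=> V FV; exists V => //; rewrite setIid; have [] := oF V FV.
Qed.

(** * Moves of Player I and traces of the answers *)

Definition moves P : set (set (hyperspace X)) :=
  [set vietoris_family F | F in [set F | F `<=` P /\ F !=set0]].

Lemma open_families_sub F P : F `<=` P -> open_families X P ->
  open_families X F.
Proof.
move=> FP [finP oP]; split; first exact: sub_finite_set FP finP.
by move=> U /FP /oP.
Qed.

Lemma open_families_moves P : open_families X P ->
  open_families (hyperspace X) (moves P).
Proof.
move=> oP; split.
  apply: finite_image; apply: sub_finite_set (finite_powerset oP.1).
  by move=> F [].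
move=> _ [F [FP F0] <-]; have oF := open_families_sub FP oP.
by split; [exact: open_vietoris_family | exact: vietoris_family_neq0].
Qed.

(** Refinement goes both ways: if each member of [F] is tied to some W_i and conversely, then the
    third clause ties each member of [G] to some W_i, and the fourth ties each W_i to some member of
    [G]. *)
Definition shrinking (O : set (set (hyperspace X))) F G :=
  [/\ open_families X G, exists2 Z, O Z & vietoris_family G `<=` Z,
      forall V, G V -> exists2 U, F U & V `<=` U &
      forall U, F U -> exists2 V, G V & V `<=` U].

(** The default [set0] is an open family, so [hull] consists of non-empty open sets even along
    illegal plays. *)
Definition answer (O : set (set (hyperspace X))) F : set (set X) :=
  xget set0 [set G | shrinking O F G].

(** A point [A] of the answer [Z] lies in <F> and in some basic <H> inside [Z]; intersections of
    members of [H] and [F] form the required family. *)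
Lemma answerP (O : open_family (hyperspace X)) F :
    open_families X F -> (exists2 Z, val O Z & Z `<=` vietoris_family F) ->
  shrinking (val O) F (answer (val O) F).
Proof.
move=> oF OF; apply: (xgetPex set0 (P := [set G | shrinking _ F G])).
move: oF OF => [finF oF] [Z OZ ZF].
have [_ /(_ _ OZ)[oZ [A ZA]]] := set_valP O.
have [H [[finH oH] H0 HA HZ]] := vietoris_family_base oZ ZA.
(* Only the traces [V `&` U] that meet [A] are kept, so that [A] still
   belongs to the smaller Vietoris set. *)
pose G := [set p.1 `&` p.2 | p in
  [set p | [/\ H p.1, F p.2 & val A `&` (p.1 `&` p.2) !=set0]]].
have [AF mAF] := ZF _ ZA; have [AH mAH] := HA.
exists G; split.
- split.
    apply: finite_image; apply: sub_finite_set (finite_setX finH finF).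
    by move=> p [].
  move=> _ [p [Hp Fp [x [_ px]]] <-]; split; last by exists x.
  by apply: openI; [exact: (oH _ Hp).1 | exact: (oF _ Fp).1].
- exists Z => // B [BG mB]; apply: HZ; split.
    by move=> x /BG[_ [p [Hp _ _] <-] [px _]]; exists p.1.
  move=> V HV; have [x [Ax Vx]] := mAH _ HV; have [U FU Ux] := AF _ Ax.
  have [|y [By [Vy _]]] := mB (V `&` U); last by exists y.
  by exists (V, U) => //; split=> //; exists x.
- by move=> _ [p [_ Fp _] <-]; exists p.2 => // x [].
- move=> U FU; have [x [Ax Ux]] := mAF _ FU; have [V HV Vx] := AH _ Ax.
  exists (V `&` U); last by move=> ? [].
  by exists (V, U) => //; split=> //; exists x.
Qed.

Lemma open_families_answer O F : open_families X (answer O F).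
Proof.
rewrite /answer; case: xgetP => [G _ []//|_].
by split; [exact: finite_set0 | move=> ? []].
Qed.

(** * The growing families and their closure under the strategy *)

Variable s : strategy X.

Definition subfamilies P : set (open_family X) := [set F | val F `<=` P].

Lemma finite_subfamilies P : finite_set P -> finite_set (subfamilies P).
Proof.
move=> finP; apply: finite_preimage (finite_powerset finP).
by move=> F G _ _; exact: val_inj.
Qed.

(** This is P_n. Stage [m.+1] reads [B m] last, so stage [n] is known to Player I before round [n].
    The bound [m] on the length of words keeps each stage finite; every length is reached in the
    union. *)
Fixpoint hull (B : nat -> open_family (hyperspace X)) n : set (set X) :=
  if n is m.+1 then
    hull B m
    `|` \bigcup_(l in words (subfamilies (hull B m)) m) val (s l)
    `|` \bigcup_(F in [set F | F `<=` hull B m]) answer (val (B m)) F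
  else set0.

Lemma open_families_bigcup (I : choiceType) (D : set I) (f : I -> set (set X)) :
  finite_set D -> (forall i, D i -> open_families X (f i)) ->
  open_families X (\bigcup_(i in D) f i).
Proof.
move=> finD of_; split; first by apply: bigcup_finite => // i /of_[].
by move=> U [i /of_[_ oU] /oU].
Qed.

Lemma open_familiesU F G : open_families X F -> open_families X G ->
  open_families X (F `|` G).
Proof.
move=> [finF oF] [finG oG]; split; first by rewrite finite_setU.
by move=> U [/oF|/oG].
Qed.

Lemma open_families_hull B n : open_families X (hull B n).
Proof.
elim: n => [|n IHn] /=; first by split; [exact: finite_set0 | move=> ? []].
apply: open_familiesU; first apply: open_familiesU => //.
  apply: open_families_bigcup; last by move=> l _; exact: set_valP.
  exact/finite_words/finite_subfamilies/IHn.1.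
apply: open_families_bigcup; first exact: finite_powerset IHn.1.
by move=> F _; exact: open_families_answer.
Qed.

Lemma eq_hull B B' n : (forall i, i < n -> B i = B' i) -> hull B n = hull B' n.
Proof.
elim: n => [//|n IHn] BB' /=; rewrite IHn ?BB'// => i ni.
by apply: BB'; exact: ltnW.
Qed.

Lemma hull_le B m n : m <= n -> hull B m `<=` hull B n.
Proof.
elim: n => [|n IHn]; first by rewrite leqn0 => /eqP->.
rewrite leq_eqVlt => /predU1P[->//|/IHn mn] U /mn nU.
by left; left.
Qed.

(** The stages increase, so the largest of finitely many indices serves for all members. *)
Lemma finite_sub_hull B F : finite_set F -> F `<=` \bigcup_n hull B n ->
  exists m, forall n, m <= n -> F `<=` hull B n.
Proof.
move=> finF FB.
have [U /FB[n _ nU]|D [finD FD _]] :=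
  @finite_choice _ _ F (fun U n => hull B n U) finF; first by exists n.
move: finD => /finite_seqP[r Dr].
exists (\max_(i <- r) i) => n rn U /FD[m]; rewrite Dr => /= mr.
by apply: hull_le; apply: leq_trans rn; exact: leq_bigmax_seq.
Qed.

Lemma strategy_hull B k (b : nat -> open_family X) :
  (forall i, i < k -> val (b i) `<=` \bigcup_n hull B n) ->
  val (s (mkseq b k)) `<=` \bigcup_n hull B n.
Proof.
move=> bB.
have : exists m, forall i, i < k -> val (b i) `<=` hull B m.
  elim: k bB => [|k IHk] bB; first by exists 0.
  have [m mP] := IHk (fun i ik => bB i (ltnW ik)).
  have [m' m'P] := finite_sub_hull (set_valP (b k)).1 (bB k (ltnSn k)).
  exists (maxn m m') => i; rewrite ltnS leq_eqVlt => /predU1P[->|ik].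
    by apply: m'P; exact: leq_maxr.
  by apply: subset_trans (mP i ik) _; apply: hull_le; exact: leq_maxl.
(* The stage must contain all [b i] with [i < k] and also admit words of length [k]. *)
move=> [m mP] U sU; exists (maxn m k).+1 => //.
left; right; exists (mkseq b k) => //; apply: words_map.
  by rewrite size_iota leq_maxr.
move=> i; rewrite mem_iota add0n /= => ik.
by apply: subset_trans (mP i ik) _; apply: hull_le; exact: leq_maxl.
Qed.

Hypothesis ws : winning_strategy s.

(** If this failed, Player II could always answer within [P] by sets missing [W]; the next move of
    [s] then stays in [P] by [strategy_hull], so the play never ends and [s] loses it. *)
Lemma hull_meet B (W : set X) : open W -> W !=set0 ->
  exists2 U, (\bigcup_n hull B n) U &
    forall V, (\bigcup_n hull B n) V -> V `<=` U -> V `&` W !=set0.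
Proof.
set P := \bigcup_n hull B n => oW W0.
apply: contrapT => noU.
have Pmiss U : P U -> exists V, [/\ P V, V `<=` U & V `&` W = set0].
  move=> PU; apply: contrapT => noV; apply: noU; exists U => // V PV VU.
  by apply/set0P/negP => /eqP VW; apply: noV; exists V.
have /choice[reply replyP] (A : open_family X) : exists C : open_family X,
    val A `<=` P -> [/\ val C `<=` P, refines C A &
                       forall V, val C V -> V `&` W = set0].
  (* Outside [P] the reply is a dummy; the play below never leaves [P]. *)
  have [AP|nAP] := pselect (val A `<=` P); last by exists A.
  have [U /AP /Pmiss //|C [finC AC CA]] := @finite_choice _ _ (val A)
    (fun U V => [/\ P V, V `<=` U & V `&` W = set0]) (set_valP A).1.
  have oC : open_families X C.
    split=> // V /CA[U _ [[n _ /(open_families_hull B n).2]//]].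
  exists (exist _ C (mem_set oC)) => _; split=> /=.
  - by move=> V /CA[U _ []].
  - by move=> U /AC[V CV [_ VU _]]; exists V.
  - by move=> V /CA[U _ []].
(* Each move of [s] depends on all past replies, so the play is built through its histories. *)
pose hist := fix hist n :=
  if n is m.+1 then rcons (hist m) (reply (s (hist m))) else [::].
pose b n := reply (s (hist n)).
have mkb n : mkseq b n = hist n.
  by elim: n => [|n IHn] //; rewrite mkseqS IHn.
have bP n : val (s (hist n)) `<=` P.
  rewrite -mkb; elim/ltn_ind: n => n IHn; apply: strategy_hull => i ni.
  by have [] := replyP _ (IHn i ni); rewrite mkb.
have [|x [Wx [n _ [V bV Vx]]]] := ws (B := b) _ 0 W0 oW.
  by move=> n; rewrite mkb; have [] := replyP _ (bP n).
have [_ _ /(_ V bV) VW] := replyP _ (bP n).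
by have : (V `&` W) x by []; rewrite VW.
Qed.

End hyperspace_of_families.

(** * The winning strategy on the hyperspace *)

Theorem theorem6 (X : topologicalType) (cX : compact_space X)
  (fX : I_favorable X) : I_favorable (hyperspace X).
Proof.
have T1 := hausdorff_accessible cX.2; have [s ws] := fX.
have oe : open_families (hyperspace X) set0.
  by split; [exact: finite_set0 | move=> ? []].
(* The family [e] only pads the history [h] to an infinite sequence; by [eq_hull] the stage [size h]
   does not see the padding. *)
pose e : open_family (hyperspace X) := exist _ set0 (mem_set oe).
pose t (h : seq (open_family (hyperspace X))) : open_family (hyperspace X) :=
  exist _ (moves (hull s (nth e h) (size h)))
    (mem_set (open_families_moves T1 (open_families_hull s _ _))).
exists t => B Bt k O [A OA] oO.
have [H [[finH oH] [W0 HW0] _ HO]] := vietoris_family_base oO OA.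
(* The members of [H] are the W_i, and [F] collects the sets U_i given by [hull_meet]. *)
have [W /oH[oW W_neq0]|F [finF HF FH]] := @finite_choice _ _ H (fun W U =>
    (\bigcup_n hull s B n) U /\ forall V, (\bigcup_n hull s B n) V ->
    V `<=` U -> V `&` W !=set0) finH.
  by have [U] := hull_meet ws B oW W_neq0; exists U.
have [|m mF] := @finite_sub_hull _ s B F finF; first by move=> U /FH[W _ []].
(* Round [n] is late enough to count for density from [k] on and for <F> to be among the moves of
   Player I. *)
pose n := maxn k m.
have FB : F `<=` hull s B n by apply: mF; exact: leq_maxr.
have [W' FW' _] := HF _ HW0.
have : shrinking (val (B n)) F (answer (val (B n)) F).
  apply: answerP.
    exact: open_families_sub FB (open_families_hull s B n).
  apply: (Bt n); exists F => //; split; last by exists W'.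
  rewrite size_mkseq (@eq_hull _ s _ B)// => i ni.
  by rewrite nth_mkseq.
set G := answer _ _; move=> [oG [Z BZ GZ] GF FG].
(* The trace [G] joins the hull at stage [n.+1], so the property of the U_i applies to its
   members. *)
have GB V : G V -> (\bigcup_n hull s B n) V.
  by move=> GV; exists n.+1 => //; right; exists F.
have [|||C [GC HC]] := @vietoris_family_meet _ T1 G H oG.1 finH.
- by have [V GV _] := FG _ FW'; exists V.
- move=> V GV; have [U FU VU] := GF _ GV; have [W HW [_ UW]] := FH _ FU.
  by exists W => //; apply: UW => //; exact: GB.
- move=> W /HF[U FU [_ UW]]; have [V GV VU] := FG _ FU.
  by exists V => //; apply: UW => //; exact: GB.
exists C; split; first exact: HO.
by exists n; [exact: leq_maxl | exists Z => //; exact: GZ].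
Qed.
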